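(* Let $n\ge 2$ and $k\ge 1$ be integers, let $f:\mathbb{R}_{>0}\to\mathbb{R}$ be an admissible force function, let $m_1,\dots,m_n>0$ be given masses and let $T(t)$ be a given admissible rotation matrix. Let $R_{T,m_1,\dots,m_n}$ be the set of all relative equilibria $\{T(t)Q_i\}_{i=1}^n$ (with rotation matrix $T(t)$ and masses $m_1,\dots,m_n$) of the generalised quasi-homogeneous $n$-body problem $$\ddot q_i=\sum_{j=1,\ j\ne i}^n m_j(q_j-q_i)f(\|q_j-q_i\|),\qquad i\in\{1,\dots,n\}.$$ If $\lim_{x\downarrow 0}xf(x)=\pm\infty$ (i.e. the limit is either $+\infty$ or $-\infty$) and $xf(x)$ is bounded for $x$ away from $0$ (i.e. bounded on $(\delta,\infty)$ for every $\delta>0$), then there exists a $C\in\mathbb{R}_{>0}$ such that for all relative equilibria $\{T(t)Q_i\}_{i=1}^n$ in $R_{T,m_1,\dots,m_n}$ we have $\|Q_i\|<C$ for all $i\in\{1,\dots,n\}$.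
   Context: $\|\cdot\|$ and $\langle\cdot,\cdot\rangle$ are the Euclidean norm and inner product on $\mathbb{R}^{k+1}$. Admissible force function: a continuous function $f:\mathbb{R}_{>0}\to\mathbb{R}$ such that $f(x)$ and $xf'(x)$ are bounded and differentiable for $x$ away from $0$ (i.e. for every $\delta>0$ both are differentiable and bounded on $(\delta,\infty)$), and $\lim_{x\downarrow 0}f(x)=\pm\infty$ (i.e. the limit is either $+\infty$ or $-\infty$). Admissible rotation matrix: a twice differentiable time-dependent invertible real $(k+1)\times(k+1)$ matrix $T(t)$ ($t$ in a nonempty open time interval) such that $\langle T(t)x,T(t)y\rangle=\langle x,y\rangle$ for all $x,y\in\mathbb{R}^{k+1}$ and all $t$, and such that there exist constants $c_1,c_2\in\mathbb{R}_{>0}$ with $c_1\|x\|\le\|T(t)^{-1}\ddot T(t)x\|\le c_2\|x\|$ for all $x\in\mathbb{R}^{k+1}$ and all $t$. Relative equilibrium with rotation matrix $T(t)$ and masses $m_1,\dots,m_n$: a solution $q_1(t),\dots,q_n(t)\in\mathbb{R}^{k+1}$ of the displayed system (in particular the $q_i(t)$ are pairwise distinct, so that the right-hand side is defined) of the form $q_i(t)=T(t)Q_i$, $i\in\{1,\dots,n\}$, with constant vectors $Q_1,\dots,Q_n\in\mathbb{R}^{k+1}$. *)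

(* Defs.v *)
From HB Require Import structures.
From mathcomp Require Import all_boot all_order all_algebra.
From mathcomp Require Import all_classical all_reals all_analysis.

Set Implicit Arguments.
Unset Strict Implicit.
Unset Printing Implicit Defensive.

Import Order.TTheory GRing.Theory Num.Theory.
Import numFieldNormedType.Exports.

Local Open Scope ring_scope.
Local Open Scope classical_set_scope.

Definition dotv (R : realType) (d : nat) (x y : 'cV[R]_d) : R :=
  \sum_(i < d) x i 0 * y i 0.

(* The library norm `|x| on matrices is the sup norm, hence this definition. *)
Definition enorm (R : realType) (d : nat) (x : 'cV[R]_d) : R :=
  Num.sqrt (dotv x x).

Definition bounded_away_from_0 (R : realType) (g : R -> R) : Prop :=
  forall delta : R, 0 < delta -> [bounded g x | x in `]delta, +oo[].

Definition derivable_away_from_0 (R : realType) (g : R -> R) : Prop :=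
  forall delta : R, 0 < delta ->
  forall x : R, x \in `]delta, +oo[ -> derivable g x 1.

Definition infinite_limit_at_0 (R : realType) (g : R -> R) : Prop :=
  g x @[x --> 0^'+] --> +oo \/ g x @[x --> 0^'+] --> -oo.

(* A function on the positive reals is a total function whose values on
   non-positive arguments are irrelevant. *)
Definition admissible_force (R : realType) (f : R -> R) : Prop :=
  [/\ {in `]0, +oo[, continuous f},
      derivable_away_from_0 f /\ bounded_away_from_0 f,
      derivable_away_from_0 (fun x => x * derive1 f x) /\
        bounded_away_from_0 (fun x => x * derive1 f x)
    & infinite_limit_at_0 f].

Definition open_time_interval (R : realType) (I : set R) : Prop :=
  [/\ open I, is_interval I & I !=set0].

(* Derivatives at points of the open set I depend only on the restriction of
   g to I. *)
Definition twice_derivable_on (R : realType) (V : normedModType R)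
    (I : set R) (g : R -> V) : Prop :=
  forall t : R, I t -> derivable g t 1 /\ derivable (derive1 g) t 1.

Definition admissible_rotation (R : realType) (k : nat) (I : set R)
    (T : R -> 'M[R]_k.+1) : Prop :=
  [/\ twice_derivable_on I T,
      forall t : R, I t -> T t \in unitmx,
      forall t : R, I t -> forall x y : 'cV[R]_k.+1,
        dotv (T t *m x) (T t *m y) = dotv x y
    & exists c1 c2 : R, [/\ 0 < c1, 0 < c2 &
        forall t : R, I t -> forall x : 'cV[R]_k.+1,
          c1 * enorm x <= enorm (invmx (T t) *m derive1n 2 T t *m x) /\
          enorm (invmx (T t) *m derive1n 2 T t *m x) <= c2 * enorm x]].

Definition nbody_solution (R : realType) (n k : nat) (I : set R) (f : R -> R)
    (m : 'I_n -> R) (q : 'I_n -> R -> 'cV[R]_k.+1) : Prop :=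
  [/\ forall t : R, I t -> forall i j : 'I_n, i != j -> q i t <> q j t,
      forall i : 'I_n, twice_derivable_on I (q i)
    & forall t : R, I t -> forall i : 'I_n,
        derive1n 2 (q i) t =
          \sum_(j < n | j != i)
            (m j * f (enorm (q j t - q i t))) *: (q j t - q i t)].

Definition relative_equilibria (R : realType) (n k : nat) (I : set R)
    (f : R -> R) (T : R -> 'M[R]_k.+1) (m : 'I_n -> R) :
    set ('I_n -> R -> 'cV[R]_k.+1) :=
  [set q | nbody_solution I f m q /\
     exists Q : 'I_n -> 'cV[R]_k.+1,
       forall (i : 'I_n) (t : R), I t -> q i t = T t *m Q i].

(* Main.v *)
Require Import Defs.
From HB Require Import structures.
From mathcomp Require Import all_boot all_order all_algebra.
From mathcomp Require Import all_classical all_reals all_analysis.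

Set Implicit Arguments.
Unset Strict Implicit.
Unset Printing Implicit Defensive.

Import Order.TTheory GRing.Theory Num.Theory.
Import numFieldNormedType.Exports.

Local Open Scope ring_scope.
Local Open Scope classical_set_scope.

(** Fix one time t and put A = T(t)^-1 T''(t); in the rotating frame the
    equations of motion read A Q_i = sum_j m_j f(|Q_j - Q_i|) (Q_j - Q_i).
    Group the bodies into clusters, the connected components of the relation
    |Q_j - Q_i| <= 1. In the sum of m_i A Q_i over a cluster the internal forces
    cancel pairwise and each external one is bounded, because x f(x) is bounded
    on ]1, +oo[. As c1 |x| <= |A x|, this bounds the centre of mass of the
    cluster, and every member of the cluster is within distance n of it.

    All estimates use the sup norm of the library, compared with the Euclidean
    norm up to a factor k + 1. *)

Lemma mx_norm_entry (R : realType) (p q : nat) (M : 'M[R]_(p, q)) i j :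
  `|M i j| <= `|M|.
Proof.
by rewrite [leRHS]/Num.Def.normr/= mx_normrE; exact: (le_bigmax _ _ (i, j)).
Qed.

Lemma mx_norm_le (R : realType) (p q : nat) (M : 'M[R]_(p, q)) (a : R) :
  0 <= a -> (forall i j, `|M i j| <= a) -> `|M| <= a.
Proof.
move=> a0 Ma.
by rewrite [leLHS]/Num.Def.normr/= mx_normrE (bigmax_le _ a0)//= => -[i j] _.
Qed.

(** The factor from [N] comes first, as a Lipschitz constant of right multiplication by [N]. *)
Lemma mx_norm_mulmx (R : realType) (p q r : nat) (M : 'M[R]_(p, q))
    (N : 'M[R]_(q, r)) : `|M *m N| <= q%:R * `|N| * `|M|.
Proof.
apply: mx_norm_le => [|i j]; first by rewrite !mulr_ge0.
rewrite mxE -mulrA -[q in q%:R]card_ord -sum1_card natr_sum mulr_suml.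
apply: (le_trans (ler_norm_sum _ _ _)); apply: ler_sum => l _.
by rewrite mul1r normrM mulrC ler_pM// mx_norm_entry.
Qed.

Lemma mulmxr_continuous (R : realType) (p q r : nat) (N : 'M[R]_(q, r)) :
  continuous (mulmxr N : 'M[R]_(p, q) -> 'M[R]_(p, r)).
Proof.
apply/linear_bounded_continuous/linear_boundedP.
exists (q%:R * `|N|); split; first exact: num_real.
move=> a Na M /=; apply: (le_trans (mx_norm_mulmx _ _)).
by rewrite ler_wpM2r// ltW.
Qed.

(** By linearity the difference quotients of [h \o g] are the images under [h] of those of [g];
    continuity of [h] passes this to the limit. *)
Lemma derive1_linear (R : realType) (V W : normedModType R)
    (h : {linear V -> W}) (g : R -> V) (t : R) :
  continuous h -> derivable g t 1 -> derive1 (h \o g) t = h (derive1 g t).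
Proof.
move=> hc gt; rewrite !derive1E; apply: cvg_lim => //.
have /(_ _) := continuous_cvg _ (hc _) gt; apply: cvg_trans.
suff -> : (fun s => s^-1 *: (((h \o g) \o shift t) (s *: 1) - (h \o g) t)) =
    h \o (fun s => s^-1 *: ((g \o shift t) (s *: 1) - g t)) by [].
by apply/funext => s; rewrite /= linearZ [in RHS]linearB.
Qed.

Lemma derive1_near_eq (R : realType) (V : normedModType R) (f g : R -> V)
    (t : R) : {near t, f =1 g} -> derive1 f t = derive1 g t.
Proof. by move=> fg; rewrite !derive1E; exact: near_eq_derive. Qed.

(** Since [I] is open, an identity valid on [I] holds near each of its points and can be
    differentiated there, here twice. *)
Lemma derive1n2_mulmx (R : realType) (p q r : nat) (I : set R)
    (T : R -> 'M[R]_(p, q)) (Q : 'M[R]_(q, r)) (g : R -> 'M[R]_(p, r)) (t : R) :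
  open I -> twice_derivable_on I T -> (forall s, I s -> g s = T s *m Q) ->
  I t -> derive1n 2 g t = derive1n 2 T t *m Q.
Proof.
move=> Io dT gE It.
have near_I s : I s -> \forall u \near s, I u.
  by move=> Is; exact: open_nbhs_nbhs.
have dg s : I s -> derive1 g s = derive1 T s *m Q.
  move=> Is; have [dTs _] := dT s Is.
  rewrite -[RHS](derive1_linear (@mulmxr_continuous _ p _ _ Q) dTs).
  by apply: derive1_near_eq; near=> u; apply: gE; near: u; exact: near_I.
have [_ dTt] := dT t It.
rewrite -[RHS](derive1_linear (@mulmxr_continuous _ p _ _ Q) dTt).
by apply: derive1_near_eq; near=> u; apply: dg; near: u; exact: near_I.
Unshelve. all: by end_near. Qed.

Lemma enorm_ge0 (R : realType) (d : nat) (x : 'cV[R]_d) : 0 <= enorm x.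
Proof. exact: sqrtr_ge0. Qed.

Lemma enormN (R : realType) (d : nat) (x : 'cV[R]_d) : enorm (- x) = enorm x.
Proof.
by congr Num.sqrt; apply: eq_bigr => i _; rewrite !mxE mulrNN.
Qed.

Lemma mx_norm_le_enorm (R : realType) (d : nat) (x : 'cV[R]_d) :
  `|x| <= enorm x.
Proof.
apply: mx_norm_le => [|i j]; first exact: enorm_ge0.
rewrite (ord1 j) -sqrtr_sqr ler_wsqrtr// /dotv (bigD1 i)//= expr2 lerDl.
by apply: sumr_ge0 => l _; rewrite -expr2 sqr_ge0.
Qed.

Lemma enorm_le_mx_norm (R : realType) (d : nat) (x : 'cV[R]_d) :
  enorm x <= d%:R * `|x|.
Proof.
case: d x => [|d] x.
  by rewrite /enorm /dotv big_ord0 sqrtr0 mul0r.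
rewrite -[leRHS]ger0_norm ?mulr_ge0// -sqrtr_sqr ler_wsqrtr// exprMn.
apply: (@le_trans _ _ (d.+1%:R * `|x| ^+ 2)).
  rewrite mulr_natl -[X in _ *+ X]card_ord -sumr_const.
  apply: ler_sum => i _; rewrite -expr2 -real_normK ?num_real//.
  by rewrite lerXn2r ?nnegrE// mx_norm_entry.
by rewrite ler_wpM2r ?sqr_ge0// expr2 ler_peMr// ler1n.
Qed.

(** A connecting path can be taken without repeated vertices; it then has fewer than [#|S|] edges,
    each contributing at most [a]. *)
Lemma connect_dist (R : realType) (V : normedModType R) (S : finType)
    (e : rel S) (Q : S -> V) (a : R) (i j : S) :
  0 <= a -> (forall i j, e i j -> `|Q i - Q j| <= a) ->
  connect e i j -> `|Q i - Q j| <= a *+ #|S|.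
Proof.
move=> a0 Qa /connectP[p + ->] => /shortenP[p' ep' /card_uniqP up' _].
apply: (@le_trans _ _ (a *+ size p')); last first.
  rewrite -subr_ge0 -mulrnBr ?mulrn_wge0//.
  by have := max_card [in i :: p']; rewrite up' => /ltnW.
elim: p' i ep' {up'} => [|l p' IH] i /=; first by rewrite subrr normr0.
move=> /andP[eil /IH {}IH]; rewrite mulrS -(subrKA (Q l)).
by apply: (le_trans (ler_normD _ _)); rewrite lerD// Qa.
Qed.

(** Exchanging the two sums shows that the total equals its own negative. *)
Lemma sum_antisym (R : realType) (V : lmodType R) (S : finType) (C : pred S)
    (F : S -> S -> V) :
  (forall i j, F j i = - F i j) -> \sum_(i in C) \sum_(j in C) F i j = 0.
Proof.
move=> FN; set s := LHS; have sN : s = - s.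
  rewrite {1}/s exchange_big/= -sumrN; apply: eq_bigr => i _.
  by rewrite -sumrN; apply: eq_bigr.
apply/eqP; have /eqP : 2%:R *: s = 0 by rewrite scaler_nat mulr2n {2}sN subrr.
by rewrite scaler_eq0 pnatr_eq0.
Qed.

(** In the bound, [n%:R] is for the distance to the centre of mass of the cluster and the other term
    for the norm of that centre. Neither depends on the cluster or on [Q]. *)
Lemma balanced_configuration_bounded (R : realType) (n d : nat) (f : R -> R)
    (m : 'I_n -> R) (A : 'M[R]_d) (Q : 'I_n -> 'cV[R]_d) (c G : R) :
  0 < c -> (forall i, 0 < m i) ->
  (forall x : 'cV[R]_d, c * enorm x <= enorm (A *m x)) ->
  (forall r, 1 < r -> `|r * f r| <= G) ->
  (forall i, A *m Q i =
     \sum_(j < n | j != i) (m j * f (enorm (Q j - Q i))) *: (Q j - Q i)) ->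
  forall i, `|Q i| <= n%:R + d%:R * (G * \sum_j m j) / c.
Proof.
move=> c0 m0 Ac fG AQ a.
pose M := \sum_j m j; rewrite -/M.
pose e := [rel i j : 'I_n | enorm (Q j - Q i) <= 1].
pose C := connect e a.
pose MC := \sum_(i in C) m i.
have MC0 : 0 < MC.
  rewrite /MC (bigD1 a)/=; last exact: connect0.
  by rewrite ltr_pwDl// sumr_ge0// => i _; exact: ltW.
have G0 : 0 <= G by apply: (le_trans _ (fG 2 _)) => //; rewrite ltr1n.
(* The weight [m i] makes the forces antisymmetric; the diagonal terms vanish whatever the value of
   [f] at 0. *)
pose F i j := (m i * (m j * f (enorm (Q j - Q i)))) *: (Q j - Q i).
have FN i j : F j i = - F i j.
  by rewrite /F -[Q i - Q j]opprB enormN scalerN mulrCA.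
pose s := \sum_(i in C) m i *: Q i.
have As : A *m s = \sum_(i in C) \sum_(j | j \notin C) F i j.
  rewrite -[RHS]add0r -[X in X + _](sum_antisym C FN) -big_split/= mulmx_sumr.
  apply: eq_bigr => i _; transitivity (\sum_j F i j); last by rewrite (bigID C).
  rewrite -scalemxAr AQ scaler_sumr [RHS](bigD1 i)//= {1}/F subrr scaler0 add0r.
  by apply: eq_bigr => j _; rewrite scalerA.
have As_le : `|A *m s| <= MC * (G * M).
  rewrite As mulr_suml; apply: (le_trans (ler_norm_sum _ _ _)).
  apply: ler_sum => i iC; apply: (le_trans (ler_norm_sum _ _ _)).
  (* The total mass [M] also counts the bodies inside the cluster, which only enlarges the bound. *)
  rewrite mulrA mulr_sumr [leRHS](bigID (fun j => j \notin C))/=.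
  rewrite ler_wpDr ?sumr_ge0// => [j _|]; first by rewrite !mulr_ge0// ltW.
  apply: ler_sum => j jC; rewrite normrZ !normrM !(gtr0_norm (m0 _)) -!mulrA.
  rewrite ler_pM2l// [leRHS]mulrC ler_pM2l//.
  (* Otherwise an edge from [i] would bring [j] into the cluster. *)
  have r1 : 1 < enorm (Q j - Q i).
    rewrite ltNge; apply: contra jC => eij.
    exact: connect_trans iC (connect1 (eij : e i j)).
  apply: le_trans (fG _ r1); rewrite normrM mulrC ler_wpM2r//.
  by rewrite ger0_norm ?enorm_ge0// mx_norm_le_enorm.
have s_le : `|s| <= d%:R * (MC * (G * M)) / c.
  rewrite ler_pdivlMr// mulrC; apply: (@le_trans _ _ (c * enorm s)).
    by rewrite ler_wpM2l ?(ltW c0)// mx_norm_le_enorm.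
  apply: (le_trans (Ac s)); apply: (le_trans (enorm_le_mx_norm _)).
  by rewrite ler_wpM2l.
(* After scaling by the cluster mass [MC], [Q a] splits into its weighted offsets from the members
   and the weighted sum [s]; both bounds are proportional to [MC]. *)
rewrite -(ler_pM2l MC0) mulrDr.
have -> : MC * `|Q a| = `|\sum_(i in C) m i *: (Q a - Q i) + s|.
  rewrite -big_split/=; under eq_bigr do rewrite -scalerDr subrK.
  by rewrite -scaler_suml normrZ gtr0_norm.
apply: (le_trans (ler_normD _ _)); rewrite lerD//; last first.
  by apply: (le_trans s_le); rewrite !mulrA [MC * _]mulrC.
rewrite mulr_suml; apply: (le_trans (ler_norm_sum _ _ _)).
apply: ler_sum => i iC; rewrite normrZ gtr0_norm// ler_pM2l// -[n]card_ord.
apply: (@connect_dist _ _ _ e) => // {iC}i j /= eij.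
by rewrite distrC (le_trans (mx_norm_le_enorm _)).
Qed.

Theorem corollary1p5 (R : realType) (n k : nat) (hn : (2 <= n)%N)
    (hk : (1 <= k)%N) (f : R -> R) (hf : admissible_force f)
    (m : 'I_n -> R) (hm : forall i : 'I_n, 0 < m i)
    (I : set R) (hI : open_time_interval I)
    (T : R -> 'M[R]_k.+1) (hT : admissible_rotation I T)
    (hlim : infinite_limit_at_0 (fun x : R => x * f x))
    (hbnd : bounded_away_from_0 (fun x : R => x * f x)) :
  exists2 C : R, 0 < C &
    forall q : 'I_n -> R -> 'cV[R]_k.+1, q \in relative_equilibria I f T m ->
    forall Q : 'I_n -> 'cV[R]_k.+1,
      (forall (i : 'I_n) (t : R), I t -> q i t = T t *m Q i) ->
    forall i : 'I_n, enorm (Q i) < C.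
Proof.
have [Io _ [t It]] := hI.
have [dT Tu Tiso [c1 [c2 [c10 _ Tc]]]] := hT.
have [G fG] : exists G, forall r, 1 < r -> `|r * f r| <= G.
  have [G0 [_ G0f]] := hbnd _ ltr01.
  (* Boundedness only says that every number strictly above [G0] is a bound. *)
  exists (G0 + 1) => r r1; apply: G0f; first by rewrite ltrDl.
  by rewrite /= in_itv/= r1.
have G0 : 0 <= G by apply: (le_trans _ (fG 2 _)) => //; rewrite ltr1n.
pose B := n%:R + k.+1%:R * (G * \sum_j m j) / c1.
have B0 : 0 <= B.
  rewrite addr_ge0// divr_ge0 ?(ltW c10)// !mulr_ge0//.
  by apply: sumr_ge0 => i _; exact: ltW.
exists (k.+1%:R * B + 1); first by rewrite ltr_wpDl// mulr_ge0.
move=> q /set_mem[[_ _ qE] _] Q qQ i.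
apply: (@le_lt_trans _ _ (k.+1%:R * B)); last by rewrite ltrDl.
apply: (le_trans (enorm_le_mx_norm _)); rewrite ler_wpM2l//.
apply: (@balanced_configuration_bounded _ _ _ f m
  (invmx (T t) *m derive1n 2 T t)) => // [x|{}i].
  by have [] := Tc t It x.
(* Applying the inverse of [T t] to the equations of motion turns [q] into [Q]; the mutual distances
   agree because [T t] is an isometry. *)
rewrite -mulmxA -(derive1n2_mulmx Io dT (qQ i) It) qE// mulmx_sumr.
apply: eq_bigr => j _; rewrite !qQ// -mulmxBr -scalemxAr mulKmx ?Tu//.
by congr ((_ * f (Num.sqrt _)) *: _); exact: Tiso.
Qed.
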